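(* For all $r,n\in\mathbb{Z}_{>0}$, $$\sum_{a\in\{1,\ldots,n\}^r}q^{\mathrm{imaj}(w_a)}=\sum_{\ell=1}^nS(r,\ell)\,[n][n-1]\cdots[n-\ell+1].$$
   Context: $q$ is an indeterminate, $[i]=\frac{q^i-1}{q-1}=q^{i-1}+\cdots+q+1$ for integers $i\ge0$, and $S(r,\ell)$ is the number of set partitions of an $r$-element set into $\ell$ nonempty subsets. For $a=(a_1,\ldots,a_r)\in\{1,\ldots,n\}^r$, $w_a\in S_n$ (in one-line notation) is the permutation obtained from the sequence $(1,2,\ldots,n,a_1,\ldots,a_r)$ by keeping only the rightmost occurrence of each integer in $\{1,\ldots,n\}$. For example, for $n=6$ and $a=(2,1,3,1,6,4,6,3,4)$, $w_a=(5,2,1,6,3,4)$. For $w=(w_1,\ldots,w_n)\in S_n$, the set of backsteps is $\mathrm{BS}(w)=\{i\in\{1,\ldots,n-1\}\mid i+1\text{ is to the left of }i\text{ in }(w_1,\ldots,w_n)\}$, and $\mathrm{imaj}(w)=\sum_{i\in\mathrm{BS}(w)}i$. *)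

(* Defs.v *)
From mathcomp Require Import all_boot all_order all_fingroup all_algebra.

Set Implicit Arguments.
Unset Strict Implicit.
Unset Printing Implicit Defensive.

Import GRing.Theory.
Local Open Scope ring_scope.

(* The letters 1, ..., n are encoded by 'I_n with a shift: the ordinal of      *)
(* value k stands for the letter k + 1. Likewise for positions.               *)

(* The indeterminate q is 'X in {poly int}. *)
Definition qint (i : nat) : {poly int} := \sum_(j < i) 'X^j.

Lemma qintE (i : nat) : qint i * ('X - 1) = 'X^i - 1.
Proof. by rewrite subrX1 mulrC. Qed.

Definition stirling2 (r l : nat) : nat :=
  #|[set P : {set {set 'I_r}} | partition P [set: 'I_r] & #|P| == l]|.

(* undup keeps the rightmost occurrence of each letter. *)
Definition w_word (n r : nat) (a : r.-tuple 'I_n) : seq 'I_n :=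
  undup (enum 'I_n ++ a).

Lemma size_w_word (n r : nat) (a : r.-tuple 'I_n) : size (w_word a) == n.
Proof.
rewrite -[X in _ == X]size_enum_ord.
apply/eqP/perm_size/uniq_perm; rewrite ?undup_uniq ?enum_uniq // => x.
by rewrite mem_undup mem_cat mem_enum.
Qed.

Lemma w_word_inj (n r : nat) (a : r.-tuple 'I_n) :
  injective (tnth (Tuple (size_w_word a))).
Proof. by apply/tuple_uniqP; rewrite undup_uniq. Qed.

(* One-line notation: the k-th letter of the word is the image of k. *)
Definition w_perm (n r : nat) (a : r.-tuple 'I_n) : 'S_n :=
  perm (@w_word_inj n r a).

(* An element i > 0 of 'I_n is the integer i of {1, ..., n-1}; as ordinals,   *)
(* i encodes the letter i + 1 and ord_pred i the letter i. The position of a  *)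
(* letter in one-line notation is its image under w^-1.                       *)
Definition backsteps (n : nat) (w : 'S_n) : {set 'I_n} :=
  [set i : 'I_n | (0 < i)%N & ((w^-1)%g i < (w^-1)%g (ord_pred i))%N].

Definition imaj (n : nat) (w : 'S_n) : nat :=
  (\sum_(i in backsteps w) i)%N.

(* Main.v *)
(* The word w_a is undup a preceded by the remaining letters in increasing
   order, so it depends only on b := undup a. If b has l letters, the a with
   undup a = b are in bijection with the partitions of the r positions into l
   blocks: ordering the blocks by their maxima, the k-th block is the set of
   positions of the k-th letter of b. It remains to see that the sum of
   q^imaj over all b of length l is [n][n-1]...[n-l+1]. Removing the last
   letter of the word of b and standardizing gives the word of some b' of
   length l-1 over n-1 letters, and appending the n possible last letters to
   a given word on n-1 letters raises imaj by 0, 1, ..., n-1 in some order. *)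

Require Import Defs.
From mathcomp Require Import all_boot all_order all_fingroup all_algebra.
From mathcomp Require Import zify.

Set Implicit Arguments.
Unset Strict Implicit.
Unset Printing Implicit Defensive.

Import GRing.Theory.

(** * Words with prescribed [undup] and set partitions of the positions *)

(** Whether [undup] drops the head depends only on the equality pattern. A dropped head is recovered
    from its later occurrence, a kept one from [undup] itself. *)
Lemma undup_same_kernel_inj (T : eqType) (x0 : T) (s t : seq T) :
  size s = size t ->
  {in gtn (size s) &, forall i j,
    (nth x0 s i == nth x0 s j) = (nth x0 t i == nth x0 t j)} ->
  undup s = undup t -> s = t.
Proof.
elim: s t => [|x s IHs] [|y t] //= [eq_sz] ker_st.
have ker_st' : {in gtn (size s) &, forall i j,
    (nth x0 s i == nth x0 s j) = (nth x0 t i == nth x0 t j)}.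
  by move=> i j lt_i lt_j; apply: (ker_st i.+1 j.+1).
have headE i : i < size s -> (x == nth x0 s i) = (y == nth x0 t i).
  by move=> lt_i; apply: (ker_st 0 i.+1).
have -> : (x \in s) = (y \in t).
  apply/(nthP x0)/(nthP x0) => -[i lt_i /esym/eqP]; rewrite -?eq_sz in lt_i *.
    by rewrite headE // => /eqP->; exists i; rewrite -?eq_sz.
  by rewrite -headE // => /eqP->; exists i.
case: (boolP (y \in t)) => [/(nthP x0)[i]|_ [-> /(IHs t eq_sz ker_st')->]//].
rewrite -eq_sz => lt_i /esym/eqP; rewrite -headE // => /eqP x_i.
have /eqP y_i : y == nth x0 t i by rewrite -headE // -x_i.
by move=> /(IHs t eq_sz ker_st') eq_st; rewrite x_i y_i eq_st.
Qed.

Lemma undup_map_in_inj (T1 T2 : eqType) (f : T1 -> T2) (s : seq T1) :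
  {in s &, injective f} -> undup (map f s) = map f (undup s).
Proof.
elim: s => //= x s IHs f_inj.
rewrite IHs; last by move=> y z sy sz; apply: f_inj; rewrite inE ?sy ?sz orbT.
have -> : (f x \in map f s) = (x \in s); last by case: ifP.
apply/mapP/idP => [[y sy /f_inj->]|sx]; rewrite ?inE ?eqxx ?sy ?orbT //.
by exists x.
Qed.

Definition kernel (T : eqType) r (a : r.-tuple T) : {set {set 'I_r}} :=
  preim_partition (tnth a) [set: 'I_r].

Lemma card_kernel (T : eqType) r (a : r.-tuple T) :
  #|kernel a| = size (undup a).
Proof.
have -> : kernel a = [set:: [seq [set j | c == tnth a j] | c <- undup a]].
  apply/setP => B; rewrite inE; apply/imsetP/mapP => -[].
    move=> i _ ->; exists (tnth a i); first by rewrite mem_undup mem_tnth.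
    by apply/setP => j; rewrite !inE.
  move=> c; rewrite mem_undup => /tnthP[i ->] ->; exists i => //.
  by apply/setP => j; rewrite !inE.
rewrite cardsE -(size_map (fun c => [set j | c == tnth a j])).
apply/card_uniqP; rewrite map_inj_in_uniq ?undup_uniq // => c d.
rewrite !mem_undup => /tnthP[i ->] _ /setP/(_ i); rewrite !inE eqxx.
by move=> /esym/eqP.
Qed.

Lemma kernel_eqP (T : eqType) r (a a' : r.-tuple T) :
  kernel a = kernel a' ->
  forall i j, (tnth a i == tnth a j) = (tnth a' i == tnth a' j).
Proof.
have blockE (s : r.-tuple T) i j :
    (j \in pblock (kernel s) i) = (tnth s i == tnth s j).
  by apply: pblock_equivalence_partition; rewrite ?inE //; split=> // /eqP->.
by move=> eq_ker i j; rewrite -!blockE eq_ker.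
Qed.

(** [kernel] maps the fibre bijectively onto the partitions with [size b] blocks; surjectivity comes
    from naming the blocks by the letters of [b]. *)
Lemma card_undup_fiber (T : finType) r (b : seq T) :
  uniq b -> #|[set a : r.-tuple T | undup a == b]| = stirling2 r (size b).
Proof.
move=> uniq_b; rewrite -(card_in_imset (f := @kernel T r)); last first.
  move=> a a' /[!inE] /eqP <- /eqP eq_u /kernel_eqP eq_ker.
  case: r a a' eq_u eq_ker => [|r] a a' eq_u eq_ker.
    by rewrite [a]tuple0 [a']tuple0.
  have x0 : T := tnth a ord0.
  apply/val_inj/(@undup_same_kernel_inj _ x0); rewrite ?size_tuple //.
  move=> i j /[!inE] lt_i lt_j.
  by have := eq_ker (Ordinal lt_i) (Ordinal lt_j); rewrite !(tnth_nth x0).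
congr #|pred_of_set _|; apply/setP => P; rewrite inE.
apply/imsetP/andP => [[a /[!inE] /eqP <- ->]|[partP /eqP cardP]].
  by rewrite card_kernel eqxx; split=> //; apply: preim_partitionP.
have [a0 ker_a0] : exists a0 : r.-tuple {set 'I_r}, kernel a0 = P.
  (* The blocks of [P] themselves serve as letters. *)
  exists [tuple pblock P i | i < r].
  rewrite -[RHS](preim_partition_pblock partP).
  by apply: eq_imset => i; apply/setP => j; rewrite !inE !tnth_mktuple.
have size_a0 : size (undup a0) = size b by rewrite -card_kernel ker_a0.
(* The renaming needs a default letter, which [b] supplies unless r = 0. *)
have [r0|[x0 bx0]] : (r = 0%N) + {x0 | x0 \in b}.
  case: (r) a0 {ker_a0} size_a0 => [|r'] a0; first by left.
  case: (b) => [/eqP|x0 b']; last by right; exists x0; apply: mem_head.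
  by rewrite size_eq0 => /eqP/undup_nil /(congr1 size); rewrite size_tuple.
- subst r; exists [tuple].
    by move: size_a0; rewrite inE [a0]tuple0 /=; case: (b).
  by rewrite -ker_a0; apply/setP => B; apply/imsetP/imsetP => -[[]].
(* The k-th entry of [undup a0] is renamed to the k-th letter of [b]. *)
pose f B := nth x0 b (index B (undup a0)).
have f_inj : {in a0 &, injective f}.
  move=> B C a0B a0C /eqP; rewrite nth_uniq -?size_a0 ?index_mem ?mem_undup //.
  by move=> /eqP/index_inj -> //; rewrite mem_undup.
exists [tuple of map f a0].
  rewrite inE /= undup_map_in_inj //; apply/eqP.
  apply: (@eq_from_nth _ x0); rewrite size_map // => k lt_k.
  by rewrite (nth_map set0) // /f index_uniq ?undup_uniq.
rewrite -ker_a0; apply: eq_imset => i; apply/setP => j; rewrite !inE.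
by rewrite !tnth_map (inj_in_eq f_inj) ?mem_tnth.
Qed.

(** * The change of imaj when a last letter is appended *)

(** The word w_a when [undup a] is [b]. Letters are plain naturals, so that alphabets of different
    sizes share one type. *)
Definition fill (n : nat) (b : seq nat) : seq nat :=
  [seq i <- iota 0 n | i \notin b] ++ b.

(** As in [backsteps], [i] encodes the letter i + 1. At 0 the comparison is of a position with
    itself, hence false. *)
Definition backstep (w : seq nat) (i : nat) : bool := index i w < index i.-1 w.

Definition word_imaj (n : nat) (w : seq nat) : nat :=
  \sum_(0 <= i < n) i * backstep w i.

Lemma mem_fill n b i : i < n -> i \in fill n b.
Proof.
by move=> lt_in; rewrite mem_cat mem_filter mem_iota /= lt_in andbT orNb.
Qed.

Lemma map_bump_iota c n :
  c <= n -> [seq bump c i | i <- iota 0 n] = iota 0 c ++ iota c.+1 (n - c).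
Proof.
move=> le_cn; rewrite -{1}(subnKC le_cn) iotaD map_cat add0n; congr cat.
  rewrite -[RHS]map_id; apply/eq_in_map => i; rewrite mem_iota /bump => /andP[_].
  by rewrite add0n ltnNge => /negbTE->.
rewrite -addn1 addnC iotaDl; apply/eq_in_map => i.
by rewrite mem_iota /bump => /andP[->].
Qed.

(** Since [c] is used at the end, the missing letters are the bumped missing letters of [b], in the
    same order. *)
Lemma fill_rcons c n (b : seq nat) :
  c <= n ->
  fill n.+1 (rcons [seq bump c i | i <- b] c) =
  rcons [seq bump c i | i <- fill n b] c.
Proof.
move=> le_cn; rewrite /fill map_cat rcons_cat; congr cat.
have ->: n.+1 = c + (n - c).+1 by lia.
rewrite iotaD filter_cat /= mem_rcons mem_head /= -filter_cat -map_bump_iota //.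
rewrite filter_map; congr map; apply: eq_filter => i /=.
rewrite mem_rcons inE (mem_map (can_inj (bumpK c))).
by rewrite eq_sym (negbTE (neq_bump c i)).
Qed.

Lemma index_rcons_bump c (w : seq nat) i :
  i \in w -> index (bump c i) (rcons [seq bump c i | i <- w] c) = index i w.
Proof.
move=> wi; rewrite -cats1 index_cat (map_f (bump c) wi).
by rewrite index_map //; exact: can_inj (bumpK c).
Qed.

Lemma index_rcons_bump_last c (w : seq nat) :
  index c (rcons [seq bump c i | i <- w] c) = size w.
Proof.
rewrite -cats1 index_cat size_map /= eqxx addn0 ifN //.
by apply/mapP => -[i _ /eqP]; rewrite (negbTE (neq_bump c i)).
Qed.

(* The increase of imaj when the letter c < n is appended to a word with
   backstep set B and the letters >= c are raised by 1: c + 1 becomes a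
   backstep, a backstep c disappears, and those above c move up by 1. *)
Definition insertion_shift n (B : nat -> bool) c : nat :=
  (if B c then 1 else c.+1) + \sum_(c.+1 <= i < n) B i.

Lemma word_imaj_rcons n c (w : seq nat) :
  {in gtn n, forall i, i \in w} -> c <= n ->
  word_imaj n.+1 (rcons [seq bump c i | i <- w] c) =
  word_imaj n w + (if c < n then insertion_shift n (backstep w) c else 0).
Proof.
move=> wP le_cn; set W := rcons _ _.
have lowE i : i < c -> backstep W i = backstep w i.
  move=> lt_ic; have b j : j < c -> bump c j = j by rewrite /bump; lia.
  rewrite /backstep -{1}(b i) // -{1}(b i.-1); last by lia.
  by rewrite !index_rcons_bump // wP // inE; lia.
(* The letter [c] comes last in [W], so it is to the left of no other letter. *)
have midE : c * backstep W c = 0.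
  case: c @W le_cn {lowE} => [|c] W le_cn //.
  rewrite /backstep index_rcons_bump_last -[c.+1.-1]/c.
  have {2}->: c = bump c.+1 c by rewrite /bump ltnn.
  rewrite index_rcons_bump ?wP // ltnNge index_size /= muln0 //.
(* Both [i] and [i.-1] are at least [c], so both are raised by 1. *)
have highE i : c < i < n -> backstep W i.+1 = backstep w i.
  move=> /andP[lt_ci lt_in].
  have b j : c <= j -> bump c j = j.+1 by rewrite /bump => ->.
  rewrite /backstep /= -(b i) ?(ltnW lt_ci) // -{2}(ltn_predK lt_ci).
  rewrite -(b i.-1); last by lia.
  by rewrite !index_rcons_bump // wP // inE; lia.
have sumlowE : \sum_(0 <= i < c) i * backstep W i =
    \sum_(0 <= i < c) i * backstep w i.
  by apply: eq_big_nat => i /andP[_ /lowE->].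
have splitE m (F : nat -> nat) : c <= m ->
    \sum_(0 <= i < m) F i = \sum_(0 <= i < c) F i + \sum_(c <= i < m) F i.
  by move=> le_cm; apply: big_cat_nat.
rewrite /word_imaj (splitE n.+1) ?leqW // (splitE n) // sumlowE.
rewrite [\sum_(c <= i < n.+1) _]big_ltn //.
rewrite midE add0n.
case: ltnP => [lt_cn | le_nc]; last first.
  rewrite [\sum_(c.+1 <= i < _) _]big_geq //.
  by rewrite [\sum_(c <= i < n) _]big_geq ?addn0.
rewrite [\sum_(c.+1 <= i < _) _]big_ltn // [\sum_(c <= i < n) _]big_ltn //.
have -> : backstep W c.+1.
  rewrite /backstep /= index_rcons_bump_last.
  have ->: c.+1 = bump c c by rewrite /bump leqnn.
  by rewrite index_rcons_bump ?index_mem wP.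
rewrite big_add1 /=.
have -> : \sum_(c.+1 <= i < n) i.+1 * backstep W i.+1 =
    \sum_(c.+1 <= i < n) i * backstep w i + \sum_(c.+1 <= i < n) backstep w i.
  by rewrite -big_split /=; apply: eq_big_nat => i /highE->; rewrite mulSn addnC.
by rewrite /insertion_shift; case: (backstep w c); lia.
Qed.

Local Open Scope ring_scope.

(* The shifts for c < k form an interval, which grows at its lower end when k
   is in B and at its upper end otherwise. *)
Lemma sum_insertion_shift_low n (B : nat -> bool) k : (k <= n)%N ->
  \sum_(c < k) 'X^(insertion_shift n B c) =
  \sum_(j < k) 'X^((\sum_(k <= i < n) B i).+1 + j) :> {poly int}.
Proof.
elim: k => [|k IHk] lt_kn; first by rewrite !big_ord0.
rewrite big_ord_recr /= IHk 1?ltnW // (big_ltn lt_kn) /insertion_shift.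
case: (B k); rewrite ?add0n; last first.
  by rewrite [RHS]big_ord_recr /= addSn addnC addSn.
rewrite [RHS]big_ord_recl /= addrC addn0 add1n; congr (_ + _).
by apply: eq_bigr => j _; rewrite /bump /=; congr ('X^_); lia.
Qed.

(** For k = n the interval of shifts is 1, ..., n; the letter c = n adds the missing 0. *)
Lemma sum_insertion_shift n (B : nat -> bool) :
  \sum_(c < n.+1) 'X^(if (c < n)%N then insertion_shift n B c else 0%N) =
  qint n.+1.
Proof.
rewrite big_ord_recr /= ltnn /qint [RHS]big_ord_recl addrC; congr (_ + _).
under eq_bigr do rewrite ltn_ord.
by rewrite sum_insertion_shift_low // big_geq.
Qed.

(** * The generating function of imaj over words without repetition *)

(** Inverse of removing the last letter and standardizing; [lift] acts on values as [bump]. *)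
Definition rcons_lift n l (p : 'I_n.+1 * l.-tuple 'I_n) : l.+1.-tuple 'I_n.+1 :=
  [tuple of rcons [tuple of map (lift p.1) p.2] p.1].

Lemma rcons_lift_inj n l : injective (@rcons_lift n l).
Proof.
move=> [c s] [d t] /(congr1 val) /rcons_inj [] /= + eq_cd; rewrite {}eq_cd.
by move=> /(inj_map (@lift_inj _ _)) /val_inj ->.
Qed.

Lemma rcons_lift_uniq n l (p : 'I_n.+1 * l.-tuple 'I_n) :
  uniq (rcons_lift p) = uniq p.2.
Proof.
rewrite /= rcons_uniq (map_inj_uniq (@lift_inj _ _)) andbC.
case: mapP => [[i _ /eqP]|_]; last by rewrite andbT.
by rewrite (negbTE (neq_lift _ _)).
Qed.

(** One inclusion suffices, as both sides have the same falling factorial as cardinality. *)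
Lemma uniq_tuple_rcons_lift n l :
  [set b : l.+1.-tuple 'I_n.+1 | uniq b] =
  @rcons_lift n l @: [set p : 'I_n.+1 * l.-tuple 'I_n | uniq p.2].
Proof.
apply/esym/eqP; rewrite eqEcard; apply/andP; split.
  apply/subsetP => _ /imsetP[p + ->]; rewrite !inE rcons_lift_uniq //.
rewrite card_imset; last exact: rcons_lift_inj.
have cardE m k : #|[set b : k.-tuple 'I_m | uniq b]| = (m ^_ k)%N.
  rewrite -[m in RHS]card_ord -card_uniq_tuples; apply: eq_card => b.
  by rewrite !inE all_predT.
have -> : [set p : 'I_n.+1 * l.-tuple 'I_n | uniq p.2] =
    setX [set: 'I_n.+1] [set b : l.-tuple 'I_n | uniq b].
  by apply/setP => -[c b]; rewrite !inE.
by rewrite cardsX cardsT card_ord !cardE ffactSS.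
Qed.

Lemma sum_imaj_fill n l : (l <= n)%N ->
  \sum_(b : l.-tuple 'I_n | uniq b) 'X^(word_imaj n (fill n (map val b))) =
  \prod_(j < l) qint (n - j).
Proof.
elim: l n => [|l IHl] [|n] // le_ln.
- rewrite big_ord0 (big_pred1 [tuple]) => [|b]; last by rewrite !tuple0.
  by rewrite /word_imaj big_geq.
- rewrite big_ord0 (big_pred1 [tuple]) => [|b]; last by rewrite !tuple0.
  rewrite -[RHS](expr0 'X); congr ('X^_).
  rewrite /fill cats0 /= (@eq_filter _ _ predT) // filter_predT /word_imaj.
  apply: big1_seq => i /andP[_]; rewrite mem_index_iota => /andP[_ lt_in].
  have idx j : (j < n.+1)%N -> index j (iota 0 n.+1) = j.
    move=> lt_jn; rewrite -{1}[j](nth_iota 0 0 lt_jn).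
    by rewrite index_uniq ?iota_uniq ?size_iota.
  by rewrite /backstep !idx //; lia.
rewrite big_ord_recl subn0.
under [in RHS]eq_bigr do rewrite /bump subSS.
rewrite -IHl // big_distrr /=.
rewrite -big_set uniq_tuple_rcons_lift big_imset /=; last
  by move=> p q _ _ /rcons_lift_inj.
rewrite (eq_bigl (fun p : 'I_n.+1 * l.-tuple 'I_n => true && uniq p.2)); last
  by move=> p; rewrite inE.
rewrite -(pair_big xpredT (fun b : l.-tuple 'I_n => uniq b)
  (fun (c : 'I_n.+1) b => 'X^(word_imaj n.+1 (fill n.+1 (map val (rcons_lift (c, b))))))) /=.
(* For fixed [b], the sum over the last letter [c] yields the factor [n+1]. *)
rewrite exchange_big /=; apply: eq_bigr => b _.
rewrite -(sum_insertion_shift n (backstep (fill n (map val b)))) big_distrl /=.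
apply: eq_bigr => c _; rewrite -exprD addnC -word_imaj_rcons; last by case: c.
  rewrite -fill_rcons; last by case: c.
  by rewrite map_rcons -!map_comp.
by move=> i; apply: mem_fill.
Qed.

(** * Back to w_a, and summation over all a *)

Lemma map_val_w_word n r (a : r.-tuple 'I_n) :
  map val (w_word a) = fill n (map val (undup a)).
Proof.
rewrite /w_word undup_cat map_cat undup_id ?enum_uniq // /fill; congr (_ ++ _).
rewrite -val_enum_ord [RHS]filter_map; congr map; apply: eq_filter => i /=.
by rewrite (mem_map val_inj) mem_undup.
Qed.

Lemma imaj_w_perm n r (a : r.-tuple 'I_n) :
  imaj (w_perm a) = word_imaj n (fill n (map val (undup a))).
Proof.
have invE i : val ((w_perm a)^-1%g i) = index (val i) (map val (w_word a)).
  rewrite index_map; last exact: val_inj.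
  set j := ((w_perm a)^-1%g i); have -> : i = w_perm a j by rewrite permKV.
  rewrite permE (tnth_nth i) index_uniq ?undup_uniq //.
  by rewrite (eqP (size_w_word a)).
rewrite -map_val_w_word /word_imaj big_mkord /imaj big_mkcond /=.
apply: eq_bigr => i _; rewrite inE !invE /backstep.
case: n a i {invE} => [|n] a [[|i] lt_i] //=.
(* [ord_pred] is computed modulo the alphabet size; on a positive ordinal it is the usual
   predecessor. *)
rewrite modnDr (modn_small (ltnW lt_i)).
by case: ifP; rewrite ?muln1 ?muln0.
Qed.

Lemma sum_undup (V : nmodType) r n (F : seq 'I_n -> V) :
  \sum_(a : r.-tuple 'I_n) F (undup a) =
  \sum_(l < n.+1) (\sum_(b : l.-tuple 'I_n | uniq b) F b) *+ stirling2 r l.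
Proof.
pose sz (a : r.-tuple 'I_n) : 'I_n.+1 := inord (size (undup a)).
have szE a : sz a = size (undup a) :> nat.
  rewrite inordK // ltnS -[n in (_ <= n)%N]card_ord.
  by rewrite -(card_uniqP (undup_uniq a)) max_card.
transitivity (\sum_(l < n.+1) \sum_(b : l.-tuple 'I_n | uniq b)
    \sum_(a : r.-tuple 'I_n | undup a == b) F b); last first.
  apply: eq_bigr => l _; rewrite -sumrMnl; apply: eq_bigr => b uniq_b.
  have := card_undup_fiber r uniq_b; rewrite size_tuple sumr_const => <-.
  congr (_ *+ _).
  by apply: eq_card => a; rewrite inE.
under [RHS]eq_bigr do rewrite (exchange_big_dep predT) //=.
(* For each [a] only the pair of l = [size (undup a)] and b = [undup a] survives. *)
rewrite exchange_big; apply: eq_bigr => a _ /=.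
have sz_a : size (undup a) == sz a by rewrite szE.
rewrite (bigD1 (sz a)) //= (big_pred1 (Tuple sz_a)) => [|b].
  rewrite big1 ?addr0 // => l neq_l; rewrite big_pred0 // => b.
  apply: contraNF neq_l => /andP[_ /eqP eq_b].
  by rewrite -val_eqE /= szE eq_b size_tuple.
move=> /=. rewrite -val_eqE /= eq_sym; case: eqP => [->|]; rewrite ?andbF //.
by rewrite undup_uniq.
Qed.

(** This removes the term l = 0: an empty family of blocks covers no position. *)
Lemma stirling2_0r r : (0 < r)%N -> stirling2 r 0 = 0%N.
Proof.
move=> r_gt0; apply/eqP; rewrite cards_eq0; apply/eqP/setP => P; rewrite !inE.
apply/negbTE/negP => /andP[/and3P[/eqP covP _ _] /eqP/cards0_eq P0].
move: covP; rewrite P0 /cover big_set0.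
by move=> /setP/(_ (Ordinal r_gt0)); rewrite !inE.
Qed.

Theorem proposition2p3 (r n : nat) (r_gt0 : (0 < r)%N) (n_gt0 : (0 < n)%N) :
  \sum_(a : r.-tuple 'I_n) 'X^(imaj (w_perm a)) =
  \sum_(1 <= l < n.+1) (stirling2 r l)%:R * \prod_(j < l) qint (n - j)
  :> {poly int}.
Proof.
under eq_bigr do rewrite imaj_w_perm.
rewrite (sum_undup r (fun b => 'X^(word_imaj n (fill n (map val b))))).
rewrite big_ord_recl stirling2_0r // mulr0n add0r big_add1 big_mkord.
apply: eq_bigr => l _; rewrite mulr_natl; congr (_ *+ _).
by rewrite sum_imaj_fill ?lift0.
Qed.
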